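(* Let $G=(V,E)$ be a hedgegraph and $k$ a positive integer. Then $E$ can be partitioned into $k$ acyclic-trimmable subsets if and only if $|E[\mathcal{P}]|\le k(|V|-|\mathcal{P}|)$ for every partition $\mathcal{P}$ of $V$.
   Context: A hedgegraph $G=(V,E)$ consists of a finite vertex set $V$ and a finite set $E$ of hedges; each hedge is a set of hyperedges (subsets of $V$), the hyperedges within one hedge are pairwise vertex-disjoint, and no hyperedge belongs to two hedges. For a partition $\mathcal{P}$ of $V$ into nonempty parts, $\delta(\mathcal{P})$ is the set of hedges containing a hyperedge that intersects at least two parts of $\mathcal{P}$, and $E[\mathcal{P}]:=E\setminus\delta(\mathcal{P})$. A trimming of a hedge $e$ chooses one hyperedge $h\in e$ and two distinct vertices $u,v\in h$ and replaces $e$ by the single edge $\{u,v\}$; a trimming of a set $F$ of hedges trims every hedge of $F$, yielding a multigraph on $V$ with $|F|$ edges. A set $F$ of hedges is acyclic-trimmable if it has a trimming that is a forest (acyclic multigraph). *)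

(* Defs.v *)
From mathcomp Require Import all_boot.

Set Implicit Arguments.
Unset Strict Implicit.
Unset Printing Implicit Defensive.

(* Hyperedges are subsets of V and hedges are sets of hyperedges. *)
Notation hedge V := {set {set V}}.

(* [trivIset] says that distinct members of a family are disjoint: for a hedge
   this is vertex-disjointness of its hyperedges, for the set of hedges it says
   that no hyperedge belongs to two hedges. *)
Record hedgegraph (V : finType) := Hedgegraph {
  hedges : {set hedge V};
  hedge_hyperedges_disjoint : forall e, e \in hedges -> trivIset e;
  hedges_disjoint : trivIset hedges
}.

Section Cuts.

Variables (V : finType) (G : hedgegraph V) (P : {set {set V}}).

Definition crosses (h : {set V}) : bool :=
  2 <= #|[set A in P | A :&: h != set0]|.

Definition hedge_cut : {set hedge V} :=
  [set e in hedges G | [exists h in e, crosses h]].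

Definition uncut_hedges : {set hedge V} := hedges G :\: hedge_cut.

End Cuts.

Section Multigraphs.

(* A multigraph on V is given by a set F of abstract edges, each edge x having
   the set of endpoints [ends x]; distinct edges may have the same endpoints. *)
Variables (V T : finType) (F : {set T}) (ends : T -> {set V}).

(* A cycle v_0 x_0 v_1 x_1 ... v_(n-1) x_(n-1) v_0 with n >= 1, where x_i joins
   v_i to v_(i+1 mod n). Two parallel edges form a cycle with n = 2, and
   a loop forms one with n = 1. *)
Definition is_cycle (vs : seq V) (xs : seq T) : Prop :=
  [/\ vs != [::], uniq vs, uniq xs, {subset xs <= F}
    & [seq ends x | x <- xs] = [seq [set p.1; p.2] | p <- zip vs (rot 1 vs)]].

Definition is_forest : Prop := forall vs xs, ~ is_cycle vs xs.

End Multigraphs.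

Section Trimming.

Variable V : finType.

Definition trims_hedge (e : hedge V) (d : {set V}) : Prop :=
  exists h u v, [/\ h \in e, u \in h, v \in h, u != v & d = [set u; v]].

(* Only the values of t on F matter. The trimmed multigraph has edge set F, so
   hedges trimmed to the same pair of vertices yield parallel edges. *)
Definition is_trimming (F : {set hedge V}) (t : hedge V -> {set V}) : Prop :=
  forall e, e \in F -> trims_hedge e (t e).

Definition acyclic_trimmable (F : {set hedge V}) : Prop :=
  exists2 t, is_trimming F t & is_forest F t.

End Trimming.

(* Main.v *)
(* For sufficiency, consider the direct sum of k copies of the graphic matroid of
   the complete graph on V, and let each hedge choose an element (i, {u, v}) where
   {u, v} lies in one of its hyperedges. A partition of the hedges into k
   acyclic-trimmable sets is an independent transversal of these choices, and
   Rado's theorem provides one as soon as |X| <= k r(X) for every set X of hedges,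
   where r(X) is the graphic rank of the union of the edges available to X. This
   is the hypothesis for the partition of V into the components of that union.
   For necessity, a forest all of whose edges lie inside the parts of P has at
   most |V| - |P| edges. *)
Require Import Defs.
From mathcomp Require Import all_boot all_algebra zify.
Set Implicit Arguments.
Unset Strict Implicit.
Unset Printing Implicit Defensive.
Import GRing.Theory.

(** * Rado's theorem for monotone submodular functions *)

Section Rado.

Variables (T Y : finType) (E : {set T}) (rho : {set Y} -> nat).
Hypothesis rho0 : rho set0 = 0.
Hypothesis rho_mono : forall A B : {set Y}, A \subset B -> rho A <= rho B.
Hypothesis rho_submod : forall A B : {set Y},
  rho (A :|: B) + rho (A :&: B) <= rho A + rho B.

Definition rado_condition (A : T -> {set Y}) :=
  forall X : {set T}, X \subset E -> #|X| <= rho (\bigcup_(e in X) A e).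

Definition remove_at (A : T -> {set Y}) e0 y e :=
  if e == e0 then A e :\ y else A e.

(** A set violating the condition after the removal must contain [e0], since otherwise its union is
    unchanged. Dropping [e0] from it turns the strict inequality into [<=]. *)
Lemma remove_at_violation A e0 y : rado_condition A ->
    ~ rado_condition (remove_at A e0 y) ->
  exists X : {set T}, [/\ X \subset E, e0 \notin X
    & rho ((A e0 :\ y) :|: \bigcup_(e in X) A e) <= #|X|].
Proof.
move=> radoA nrado.
have : ~~ [forall (X : {set T} | X \subset E),
    #|X| <= rho (\bigcup_(e in X) remove_at A e0 y e)].
  by apply/negP=> /forall_inP.
case/forall_inPn=> X sXE; rewrite -ltnNge => ltX.
case e0X: (e0 \in X); last first.
  have eqA : \bigcup_(e in X) remove_at A e0 y e = \bigcup_(e in X) A e.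
    apply: eq_bigr => e eX; rewrite /remove_at; case: eqP => // eqe.
    by rewrite -eqe eX in e0X.
  by move: ltX; rewrite eqA ltnNge radoA.
exists (X :\ e0); split.
- exact: subset_trans (subD1set _ _) sXE.
- by rewrite setD11.
rewrite (cardsD1 e0) e0X add1n ltnS in ltX; apply: leq_trans ltX.
rewrite [X in _ <= rho X](big_setD1 e0) //= {1}/remove_at eqxx.
rewrite [X in _ <= rho (_ :|: X)](eq_bigr A) // => e.
by rewrite !inE /remove_at => /andP[/negbTE->].
Qed.

(* If both removals failed, on X + e0 and on Z + e0, submodularity would give
   |X| + |Z| >= |X U Z U {e0}| + |X n Z|. *)
Lemma rado_shrink A e0 x y : e0 \in E -> x != y -> rado_condition A ->
  rado_condition (remove_at A e0 x) \/ rado_condition (remove_at A e0 y).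
Proof.
move=> e0E neq_xy radoA.
have dec B : rado_condition B \/ ~ rado_condition B.
  case: (boolP [forall (X : {set T} | X \subset E), #|X| <= rho (\bigcup_(e in X) B e)]).
    by move/forall_inP; left.
  by move=> nB; right=> /forall_inP; apply/negP.
case: (dec (remove_at A e0 x)) => [|/(remove_at_violation radoA)]; first by left.
case=> X [sXE e0X leX].
case: (dec (remove_at A e0 y)) => [|/(remove_at_violation radoA)]; first by right.
case=> Z [sZE e0Z leZ].
(* As [x != y], the sets [A e0 :\ x] and [A e0 :\ y] together cover [A e0], so Rado's condition can
   be used for [X :|: Z] with [e0] added. *)
have leU : #|e0 |: (X :|: Z)| <=
    rho ((A e0 :\ x :|: \bigcup_(e in X) A e)
         :|: (A e0 :\ y :|: \bigcup_(e in Z) A e)).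
  apply: leq_trans (radoA _ _) (rho_mono _).
    by rewrite subUset sub1set e0E subUset sXE.
  apply/bigcupsP=> e; rewrite !inE => /or3P[/eqP->|eX|eZ].
  - by apply/subsetP=> z zA; rewrite !inE zA !andbT; case: eqVneq => [->|//]; rewrite neq_xy orbT.
  - by apply: subset_trans (subsetUl _ _); apply: subset_trans (subsetUr _ _); exact: bigcup_sup.
  - by do 2![apply: subset_trans (subsetUr _ _)]; exact: bigcup_sup.
have leI : #|X :&: Z| <=
    rho ((A e0 :\ x :|: \bigcup_(e in X) A e)
         :&: (A e0 :\ y :|: \bigcup_(e in Z) A e)).
  apply: leq_trans (radoA _ _) (rho_mono _).
    exact: subset_trans (subsetIl _ _) sXE.
  apply/bigcupsP=> e; rewrite inE => /andP[eX eZ]; rewrite subsetI.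
  by apply/andP; split; apply: subset_trans (subsetUr _ _); exact: bigcup_sup.
move: leU; rewrite cardsU1 !inE (negbTE e0X) (negbTE e0Z) /=.
have := cardsUI X Z; have := rho_submod (A e0 :\ x :|: \bigcup_(e in X) A e)
  (A e0 :\ y :|: \bigcup_(e in Z) A e).
lia.
Qed.

(* Shrink the sets A e one element at a time until they are singletons. *)
Theorem rado (y0 : Y) (A : T -> {set Y}) : rado_condition A ->
  exists x : T -> Y, {in E, forall e, x e \in A e}
    /\ forall X : {set T}, X \subset E -> #|X| <= rho (x @: X).
Proof.
have [n] := ubnP (\sum_(e in E) #|A e|).
elim: n A => // n IHn A /[!ltnS] leAn radoA.
case: (boolP [forall e in E, #|A e| <= 1]) => [/forall_inP A1 | ].
  (* Rado's condition for [[set e]], together with [rho0], excludes an empty [A e]. *)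
  have exA e : e \in E -> exists y, A e = [set y].
    move=> eE; apply/cards1P; rewrite eqn_leq A1 //= card_gt0; apply/eqP=> Ae0.
    have := radoA [set e]; rewrite sub1set eE cards1 big_set1 Ae0 rho0.
    by move/(_ isT).
  (* The default [y0] can be reached only for [e] outside [E]. *)
  exists (fun e => odflt y0 [pick y in A e]).
  have xA e : e \in E -> A e = [set odflt y0 [pick y in A e]].
    case/exA=> y ->; case: pickP => [z /set1P-> // | /(_ y)].
    by rewrite set11.
  split=> [e eE | X sXE]; first by rewrite {2}xA // set11.
  apply: leq_trans (radoA X sXE) (rho_mono _).
  apply/bigcupsP=> e eX; rewrite xA ?(subsetP sXE) // sub1set.
  exact: imset_f.
case/forall_inPn=> e0 e0E; rewrite -ltnNge => /card_gt1P[x [y [xA yA neq_xy]]].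
have shrink z : z \in A e0 -> rado_condition (remove_at A e0 z) ->
    exists x : T -> Y, {in E, forall e, x e \in A e}
      /\ forall X : {set T}, X \subset E -> #|X| <= rho (x @: X).
  move=> zA /IHn[|f [fA rhof]].
    apply: leq_trans leAn; rewrite (bigD1 e0) // [X in _ < X](bigD1 e0) //=.
    rewrite /remove_at eqxx (cardsD1 z (A e0)) zA add1n ltnS leq_add2l.
    by apply: leq_sum => e /andP[_ /negbTE->].
  exists f; split=> // e eE; have := fA e eE; rewrite /remove_at.
  by case: eqP => // _ /setD1P[].
by case: (rado_shrink e0E neq_xy radoA); apply: shrink.
Qed.

End Rado.

(** * Forests whose edges respect a labelling of the vertices *)

Section ForestBound.

Variables (V T : finType) (ends : T -> {set V}).

Definition adjacent (F : {set T}) (u v : V) :=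
  [exists x in F, ends x == [set u; v]].

(** The last conjunct carries the induction: later edges stay inside [p], so they differ from the
    first edge, which contains [u]. *)
Lemma path_edges (F : {set T}) u p : path (adjacent F) u p -> uniq (u :: p) ->
  exists xs, [/\ uniq xs, {subset xs <= F},
      [seq ends x | x <- xs] = [seq [set q.1; q.2] | q <- zip (u :: p) p]
    & forall x, x \in xs -> ends x \subset u :: p].
Proof.
elim: p u => [|v p IHp] u; first by exists [::].
move=> /= /andP[/exists_inP[x xF /eqP ends_x] pth] /andP[up uniqp].
have [xs [uniq_xs sxsF ends_xs sub_xs]] := IHp _ pth uniqp.
exists (x :: xs); split=> /=; last 2 first.
- by rewrite ends_x ends_xs.
- move=> z /[!inE] /predU1P[-> | /sub_xs /subsetP sub_z]; apply/subsetP=> w.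
    by rewrite ends_x !inE => /orP[]->; rewrite ?orbT.
  by move=> /sub_z wp; rewrite inE wp orbT.
- rewrite uniq_xs andbT; apply: contra up => /sub_xs /subsetP; apply.
  by rewrite ends_x set21.
by move=> z /[!inE] /predU1P[->|/sxsF].
Qed.

(** A simple path from [u] to [v] avoiding [x] would be closed to a cycle by [x]. The case [u = v]
    excludes loops. *)
Lemma forest_disconnects (F : {set T}) x u v : is_forest F ends -> x \in F ->
  ends x = [set u; v] -> ~~ connect (adjacent (F :\ x)) u v.
Proof.
move=> forestF xF ends_x; apply/negP=> /connectP[p0 pth0].
case: (shortenP pth0) => p pth uniqp _ eqv {p0 pth0}.
have [xs [uniq_xs sxsF ends_xs _]] := path_edges pth uniqp.
apply: (forestF (u :: p) (rcons xs x)); split=> //.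
- by rewrite rcons_uniq uniq_xs andbT; apply/negP=> /sxsF; rewrite setD11.
- move=> z; rewrite mem_rcons inE => /predU1P[-> // | /sxsF].
  by case/setD1P.
rewrite map_rcons ends_xs rot1_cons ends_x.
have -> : zip (u :: p) (rcons p u) = rcons (zip (u :: p) p) (v, u).
  (* The closing vertex is generalized to [b], because the induction on [p] moves only the starting
     vertex. *)
  rewrite eqv; move: {2 5}u => b.
  by elim: p (u) {pth uniqp eqv ends_xs} => //= w p IHp a; rewrite IHp.
by rewrite map_rcons /= setUC.
Qed.

(* Induction on F: deleting an edge x = {u, v} disconnects u from v, so f can be
   refined by the component of u in F - x, which gives it a new value. *)
Lemma forest_card (C : finType) (F : {set T}) (f : V -> C) :
    is_forest F ends ->
    (forall x, x \in F -> exists u v, ends x = [set u; v] /\ f u = f v) ->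
  #|F| + #|f @: [set: V]| <= #|V|.
Proof.
have [n] := ubnP #|F|.
(* [C] is generalized because the refined labelling takes values in [C * bool]. *)
elim: n C F f => // n IHn C F f /[!ltnS] leFn forestF constf.
have [->|[x xF]] := set_0Vmem F.
  by rewrite cards0 add0n (leq_trans (leq_imset_card _ _)) ?cardsT.
have [u [v [ends_x fuv]]] := constf x xF.
have nuv := forest_disconnects forestF xF ends_x.
pose g w := (f w, connect (adjacent (F :\ x)) u w).
rewrite (cardsD1 x) xF in leFn *.
have forestF' : is_forest (F :\ x) ends.
  move=> vs xs [? ? ? sxs ?]; apply: (forestF vs xs); split=> // z /sxs.
  by case/setD1P.
have adj_sym : connect_sym (adjacent (F :\ x)).
  by apply: sym_connect_sym => a b; rewrite /adjacent setUC.
have constg z : z \in F :\ x -> exists a b, ends z = [set a; b] /\ g a = g b.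
  move=> zF; have [a [b [ends_z fab]]] := constf z (subsetP (subD1set _ _) _ zF).
  exists a, b; split=> //; rewrite /g fab; congr (_, _).
  apply: same_connect_r => //; apply: connect1.
  by apply/exists_inP; exists z => //; rewrite ends_z.
have := IHn _ _ g leFn forestF' constg.
suff : #|f @: [set: V]| < #|g @: [set: V]| by lia.
have -> : f @: [set: V] = fst @: (g @: [set: V]).
  by rewrite -imset_comp; apply: eq_imset.
rewrite ltn_neqAle leq_imset_card andbT; apply/imset_injP=> inj_fst.
have /eqP := inj_fst (g u) (g v) (imset_f _ (in_setT _)) (imset_f _ (in_setT _)) fuv.
by rewrite /g xpair_eqE connect0 (negbTE nuv) andbF.
Qed.

End ForestBound.

(** * Graphic rank by linear algebra over F_2 *)

Section EdgeSpace.

Variable V : finType.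

(* Over F_2 edges need no orientation, and the graphic rank is the dimension of
   the span of the incidence vectors, so submodularity is linear algebra. *)
Definition incidence (d : {set V}) : {ffun V -> ('F_2)^o} :=
  [ffun u => (u \in d)%:R%R].

Definition edge_space (S : {set {set V}}) : {vspace {ffun V -> ('F_2)^o}} :=
  (\sum_(d in S) <[incidence d]>)%VS.

Lemma mem_edge_space (S : {set {set V}}) d : d \in S -> incidence d \in edge_space S.
Proof. by move=> dS; rewrite memvE (sumv_sup d). Qed.

Lemma edge_spaceS (A B : {set {set V}}) :
  A \subset B -> (edge_space A <= edge_space B)%VS.
Proof.
move=> /subsetP sAB; apply/subv_sumP=> d /sAB dB.
by rewrite -memvE mem_edge_space.
Qed.

Lemma edge_space0 : edge_space set0 = 0%VS.
Proof. by rewrite /edge_space big_set0. Qed.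

Lemma edge_spaceU (A B : {set {set V}}) :
  edge_space (A :|: B) = (edge_space A + edge_space B)%VS.
Proof.
apply/eqP; rewrite eqEsubv subv_add !edge_spaceS ?subsetUl ?subsetUr // !andbT.
apply/subv_sumP=> d /setUP[dA|dB]; rewrite -memvE.
  exact: subvP (addvSl _ _) _ (mem_edge_space dA).
exact: subvP (addvSr _ _) _ (mem_edge_space dB).
Qed.

(** The span of [A :&: B] is only contained in the intersection of the two spans, so the dimension
    formula for sums becomes an inequality. *)
Lemma dim_edge_space_submod (A B : {set {set V}}) :
  \dim (edge_space (A :|: B)) + \dim (edge_space (A :&: B))
    <= \dim (edge_space A) + \dim (edge_space B).
Proof.
rewrite edge_spaceU -[X in _ <= X]dimv_sum_cap leq_add2l dimvS //.
by rewrite subv_cap !edge_spaceS ?subsetIl ?subsetIr.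
Qed.

Lemma dim_edge_space_leq (S : {set {set V}}) : \dim (edge_space S) <= #|S|.
Proof.
rewrite -sum1_card; apply: leq_trans (dimv_leq_sum _ _ _) _.
by apply: leq_sum => d _; rewrite dim_vline; case: (_ != _).
Qed.

Lemma incidenceU1 (u v : V) : u != v ->
  incidence [set u; v] = (incidence [set u] + incidence [set v])%R.
Proof.
move=> neq_uv; apply/ffunP=> w; rewrite !ffunE !inE.
by case: (eqVneq w u) => [->|_]; rewrite ?(negbTE neq_uv) ?addr0 ?add0r.
Qed.

Lemma incidence_basis (U : {vspace {ffun V -> ('F_2)^o}}) :
  (forall u, incidence [set u] \in U) -> U = fullv.
Proof.
move=> memU; apply/eqP; rewrite eqEsubv subvf; apply/subvP=> f _.
have -> : f = (\sum_u f u *: incidence [set u])%R.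
  apply/ffunP=> w; rewrite sum_ffunE (bigD1 w) //= big1 ?addr0.
    by rewrite !ffunE inE eqxx /GRing.scale /= mulr1.
  by move=> u neq_uw; rewrite !ffunE inE eq_sym (negbTE neq_uw) scaler0.
by apply: rpred_sum => u _; rewrite rpredZ.
Qed.

(** When [S] consists of pairs, this is connectedness in the graph [S]. In terms of the span, it is
    an equivalence because [edge_space S] is a subspace. *)
Definition joined (S : {set {set V}}) (u v : V) : bool :=
  (incidence [set u] - incidence [set v])%R \in edge_space S.

Lemma joined_equiv S : {in [set: V] & &, equivalence_rel (joined S)}.
Proof.
move=> u v w _ _ _; rewrite /joined subrr rpred0; split=> // uv.
by rewrite -(subrKA (incidence [set v])) rpredDl.
Qed.

Definition joined_parts S := equivalence_partition (joined S) [set: V].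

Lemma joined_parts_partition S : partition (joined_parts S) [set: V].
Proof. exact: equivalence_partitionP (joined_equiv S). Qed.

(** Adding one representative vertex per part to [S] spans the whole space: the vector of [u] is its
    difference from that of its representative plus the latter. *)
Lemma card_joined_parts S : #|V| <= \dim (edge_space S) + #|joined_parts S|.
Proof.
(* For nonempty [B] this is a singleton, kept as a set so that it can be adjoined to [S]. *)
pose rep (B : {set V}) := [set x | [pick y in B] == Some x].
pose reps := rep @: joined_parts S.
have full : edge_space (S :|: reps) = fullv.
  apply: incidence_basis => u; rewrite edge_spaceU.
  have partS := joined_parts_partition S.
  have uP : u \in cover (joined_parts S) by rewrite (cover_partition partS) inE.
  have BP := pblock_mem uP.
  have repP : rep (pblock (joined_parts S) u) \in reps by exact: imset_f.
  move: (repP); rewrite {1}/rep; case: pickP => [v | /(_ u)]; last first.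
    by rewrite mem_pblock uP.
  rewrite (pblock_equivalence_partition (joined_equiv S)) ?inE // => uv.
  have -> : [set x | Some v == Some x] = [set v].
    by apply/setP=> x; rewrite !inE eq_sym.
  move=> vP; rewrite -[incidence [set u]](subrK (incidence [set v])).
  by apply: memv_add => //; apply: mem_edge_space.
have -> : #|V| = \dim (edge_space (S :|: reps)).
  by rewrite full dimvf /dim /= muln1.
rewrite edge_spaceU (leq_trans (dimv_add_leqif _ _)) // leq_add2l.
exact: leq_trans (dim_edge_space_leq _) (leq_imset_card _ _).
Qed.

Lemma joined_edge (S : {set {set V}}) u v :
  u != v -> [set u; v] \in S -> joined S u v.
Proof.
move=> neq_uv /mem_edge_space; rewrite incidenceU1 // /joined.
(* In characteristic 2 the vector of an edge is also the difference of the vectors of its ends. *)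
suff -> : (- incidence [set v] = incidence [set v])%R by [].
by apply/ffunP=> w; rewrite !ffunE oppr_pchar2 // pchar_Fp.
Qed.

(** Each vertex of a cycle is an end of two of its consecutive pairs, so its contributions cancel in
    characteristic 2. The hypothesis on [ends] excludes loops, whose vectors would not vanish. *)
Lemma cycle_incidence0 (T : finType) (F : {set T}) (ends : T -> {set V}) vs xs :
    (forall x, x \in F -> exists u v, u != v /\ ends x = [set u; v]) ->
    is_cycle F ends vs xs ->
  (\sum_(x <- xs) incidence (ends x) = 0)%R.
Proof.
move=> endsF [_ _ _ sxsF ends_xs].
rewrite -(big_map ends xpredT incidence) ends_xs.
have neqs : all (fun p => p.1 != p.2) (zip vs (rot 1 vs)).
  apply/allP=> [[a b] ab]; apply/eqP=> /= eq_ab.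
  have : [set a; b] \in [seq ends x | x <- xs].
    by rewrite ends_xs; apply/mapP; exists (a, b).
  case/mapP=> x /sxsF /endsF [u [v [neq_uv ->]]] /(congr1 (fun A : {set V} => #|A|)).
  by rewrite !cards2 neq_uv eq_ab eqxx.
rewrite big_map (eq_big_seq (fun p => incidence [set p.1] + incidence [set p.2])%R);
  last by move=> p /(allP neqs) /incidenceU1.
rewrite big_split /= -(big_map fst xpredT (fun u => incidence [set u])).
rewrite -(big_map snd xpredT (fun u => incidence [set u])).
rewrite -/unzip1 -/unzip2 unzip1_zip ?unzip2_zip ?size_rot //.
(* The second ends run through [rot 1 vs], a permutation of [vs], so the two sums are equal. *)
rewrite [X in (_ + X)%R](perm_big vs) /=; last by rewrite perm_rot.
by apply/ffunP=> w; rewrite !ffunE addrr_pchar2 // pchar_Fp.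
Qed.

(** On a cycle, the vector of one edge is a combination of the others, so the dimension is less than
    the number of edges. Parallel edges count separately in [#|X|] but merge in [ends @: X], so they
    are excluded too. *)
Lemma independent_forest (T : finType) (F : {set T}) (ends : T -> {set V}) :
    (forall x, x \in F -> exists u v, u != v /\ ends x = [set u; v]) ->
    (forall X : {set T}, X \subset F -> #|X| <= \dim (edge_space (ends @: X))) ->
  is_forest F ends.
Proof.
move=> endsF indF vs xs cyc; have := cycle_incidence0 endsF cyc.
case: cyc => vs_n0 _ uniq_xs sxsF ends_xs.
case: xs => [|x xs] in uniq_xs sxsF ends_xs *.
  by case: vs vs_n0 ends_xs => //= v vs _; rewrite rot1_cons; case: vs.
rewrite big_cons => /eqP; rewrite addr_eq0 => /eqP inc_x.
have sXF : [set y in x :: xs] \subset F by apply/subsetP=> y /[!inE]; exact: sxsF.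
have := indF _ sXF; apply/negP; rewrite -ltnNge.
have -> : #|[set y in x :: xs]| = (size xs).+1.
  by rewrite cardsE; move/card_uniqP: uniq_xs.
rewrite ltnS.
have : (edge_space (ends @: [set y in x :: xs]) <= <<[seq incidence (ends y) | y <- xs]>>)%VS.
  apply/subv_sumP=> d /imsetP[y /[!inE] /predU1P[->|yxs] ->]; rewrite -memvE.
    rewrite inc_x rpredN big_seq; apply: rpred_sum => z zxs.
    by apply: memv_span; exact: map_f.
  by apply: memv_span; exact: map_f.
move/dimvS => /leq_trans -> //.
by apply: leq_trans (dim_span _) _; rewrite size_map.
Qed.

End EdgeSpace.

(** * The direct sum of [k] copies of the edge space *)

Section ColoredRank.

Variables (V : finType) (k : nat).
Implicit Types (A B : {set 'I_k * {set V}}).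

Definition color_class A (i : 'I_k) : {set {set V}} := [set d | (i, d) \in A].

Definition colored_rank A := \sum_(i < k) \dim (edge_space (color_class A i)).

Lemma colored_rank0 : colored_rank set0 = 0.
Proof.
rewrite /colored_rank big1 // => i _.
have -> : color_class set0 i = set0 by apply/setP=> d; rewrite !inE.
by rewrite edge_space0 dimv0.
Qed.

Lemma colored_rankS A B : A \subset B -> colored_rank A <= colored_rank B.
Proof.
move=> /subsetP sAB; apply: leq_sum => i _; apply/dimvS/edge_spaceS.
by apply/subsetP=> d /[!inE]; exact: sAB.
Qed.

Lemma colored_rank_submod A B :
  colored_rank (A :|: B) + colored_rank (A :&: B)
    <= colored_rank A + colored_rank B.
Proof.
rewrite /colored_rank -!big_split; apply: leq_sum => i _.
rewrite -[X in _ <= X]/(_ + _) /=.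
have -> : color_class (A :|: B) i = color_class A i :|: color_class B i.
  by apply/setP=> d; rewrite !inE.
have -> : color_class (A :&: B) i = color_class A i :&: color_class B i.
  by apply/setP=> d; rewrite !inE.
exact: dim_edge_space_submod.
Qed.

Lemma colored_rank_setX (S : {set {set V}}) :
  colored_rank (setX [set: 'I_k] S) = k * \dim (edge_space S).
Proof.
rewrite /colored_rank (eq_bigr (fun=> \dim (edge_space S))).
  by rewrite sum_nat_const card_ord.
move=> i _; congr (\dim (edge_space _)).
by apply/setP=> d; rewrite !inE.
Qed.

(** Reduces independence in the direct sum to independence of the edges within one color. *)
Lemma colored_rank_monochromatic A i : (forall y, y \in A -> y.1 = i) ->
  colored_rank A = \dim (edge_space (snd @: A)).
Proof.
move=> Ai; rewrite /colored_rank (bigD1 i) //= big1 ?addn0 => [|j neq_ji].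
  congr (\dim (edge_space _)); apply/setP=> d; rewrite inE; apply/idP/imsetP.
    by exists (i, d).
  by case=> [[j e]] jA ->; rewrite -(Ai _ jA).
suff -> : color_class A j = set0 by rewrite edge_space0 dimv0.
by apply/setP=> d; rewrite !inE; apply/negP=> /Ai /eqP; apply/negP.
Qed.

End ColoredRank.

(** * Trimmings, uncut hedges and Rado's condition *)

Section Hedges.

Variable V : finType.

Definition trimmed_edges (e : hedge V) : {set {set V}} :=
  [set d | [exists h in e, exists u in h, exists v in h,
              (u != v) && (d == [set u; v])]].

Lemma trimmed_edgesP (e : hedge V) d :
  reflect (trims_hedge e d) (d \in trimmed_edges e).
Proof.
rewrite inE; apply: (iffP exists_inP).
  case=> h he /exists_inP[u uh /exists_inP[v vh /andP[neq_uv /eqP->]]].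
  by exists h, u, v.
case=> h [u [v [he uh vh neq_uv ->]]]; exists h => //.
by apply/exists_inP; exists u => //; apply/exists_inP; exists v; rewrite ?neq_uv ?eqxx.
Qed.

Lemma crossesPn (P : {set {set V}}) (h : {set V}) : partition P [set: V] ->
  reflect {in h &, forall u v, pblock P u = pblock P v} (~~ crosses P h).
Proof.
move=> partP; have covP u : u \in cover P by rewrite (cover_partition partP) inE.
have trivP := partition_trivIset partP.
rewrite /crosses; apply: (iffP idP) => [/card_gt1P ncr u v uh vh | constP].
  apply/eqP; apply/negPn/negP=> neq_uv; apply: ncr.
  exists (pblock P u), (pblock P v); split=> //; rewrite inE pblock_mem //.
    by apply/set0Pn; exists u; rewrite inE mem_pblock covP.
  by apply/set0Pn; exists v; rewrite inE mem_pblock covP.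
apply/card_gt1P=> -[A [B []]].
move=> /[!inE] /andP[AP /set0Pn[u /setIP[uA uh]]] /andP[BP /set0Pn[v /setIP[vB vh]]].
by rewrite -(def_pblock trivP AP uA) -(def_pblock trivP BP vB) (constP u v) ?eqxx.
Qed.

Lemma uncut_hedgesP (G : hedgegraph V) (P : {set {set V}}) e :
    partition P [set: V] ->
  reflect (e \in hedges G /\ forall h, h \in e ->
             {in h &, forall u v, pblock P u = pblock P v})
          (e \in uncut_hedges G P).
Proof.
move=> partP; rewrite !inE; case eG: (e \in hedges G) => /=; last first.
  by constructor=> -[].
rewrite andbT; apply: (iffP exists_inPn) => [ncr | [_ constP] h he].
  by split=> // h /ncr /(crossesPn _ partP).
by apply/crossesPn => //; exact: constP.
Qed.

(** This is [forest_card] for the labelling [pblock P], whose image is [P]: an uncut hedge is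
    trimmed to an edge inside one part. *)
Lemma card_uncut_forest (G : hedgegraph V) (P : {set {set V}}) F :
    partition P [set: V] -> acyclic_trimmable F ->
  #|uncut_hedges G P :&: F| <= #|V| - #|P|.
Proof.
move=> partP [t trim_t forestF].
have forestI : is_forest (uncut_hedges G P :&: F) t.
  move=> vs xs [? ? ? sxs ?]; apply: (forestF vs xs); split=> // z /sxs.
  by case/setIP.
have constP e : e \in uncut_hedges G P :&: F ->
    exists u v, t e = [set u; v] /\ pblock P u = pblock P v.
  case/setIP=> /(uncut_hedgesP _ _ partP)[_ constP] /trim_t.
  by case=> h [u [v [he uh vh _ ->]]]; exists u, v; split=> //; exact: constP he _ _ uh vh.
have := forest_card forestI constP.
have -> : pblock P @: [set: V] = P.
  apply/setP=> B; apply/imsetP/idP => [[u _ ->]|BP].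
    by rewrite pblock_mem // (cover_partition partP) inE.
  have /set0Pn[u uB] := partition_neq0 partP BP.
  by exists u; rewrite ?inE // (def_pblock (partition_trivIset partP) BP uB).
(* Subtraction truncates at 0, so [#|P| <= #|V|] is needed as well; it also follows from [leV]. *)
move=> leV; rewrite -(leq_add2r #|P|) subnK //.
exact: leq_trans (leq_addl _ _) leV.
Qed.

(** No hedge of [X] is cut by the parts joined by [S], since any two distinct vertices of one of its
    hyperedges form a pair in [S]. *)
Lemma rado_condition_hedges (G : hedgegraph V) k :
    (forall P : {set {set V}}, partition P [set: V] ->
       #|uncut_hedges G P| <= k * (#|V| - #|P|)) ->
  rado_condition (hedges G) (@colored_rank V k)
    (fun e => setX [set: 'I_k] (trimmed_edges e)).
Proof.
move=> uncut_le X sXG.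
pose S := \bigcup_(e in X) trimmed_edges e.
have -> : \bigcup_(e in X) setX [set: 'I_k] (trimmed_edges e) = setX [set: 'I_k] S.
  apply/setP=> -[i d]; rewrite inE /= in_setT /=.
  by apply/bigcupP/bigcupP=> -[e eX]; rewrite ?in_setX ?in_setT => de;
    exists e; rewrite ?in_setX ?in_setT.
rewrite colored_rank_setX.
have partS := joined_parts_partition S.
apply: (@leq_trans #|uncut_hedges G (joined_parts S)|).
  apply/subset_leq_card/subsetP=> e eX; apply/(uncut_hedgesP _ _ partS).
  split=> [|h he u v uh vh]; first exact: (subsetP sXG).
  have [-> // | neq_uv] := eqVneq u v.
  apply/esym/same_pblock; first exact: partition_trivIset partS.
  rewrite (pblock_equivalence_partition (@joined_equiv _ S)) ?inE //.
  apply: joined_edge => //; apply/bigcupP; exists e => //.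
  by apply/trimmed_edgesP; exists h, u, v.
apply: leq_trans (uncut_le _ partS) _; rewrite leq_mul2l leq_subLR.
by rewrite addnC card_joined_parts orbT.
Qed.

End Hedges.

Theorem theorem1p4 (V : finType) (G : hedgegraph V) (k : nat) (hk : 0 < k) :
  (exists F : 'I_k -> {set hedge V},
     [/\ forall i j : 'I_k, i != j -> [disjoint F i & F j],
         \bigcup_(i < k) F i = hedges G
       & forall i : 'I_k, acyclic_trimmable (F i)])
  <->
  (forall P : {set {set V}}, partition P [set: V] ->
     #|uncut_hedges G P| <= k * (#|V| - #|P|)).
Proof.
split=> [[F [_ coverF acyclicF]] P partP | uncut_le].
  have -> : uncut_hedges G P = \bigcup_(i < k) (uncut_hedges G P :&: F i).
    rewrite -big_distrr /= coverF; apply/esym/setIidPl; exact: subsetDl.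
  apply: (@leq_trans (\sum_(i < k) #|uncut_hedges G P :&: F i|)).
    elim/big_rec2: _ => [|i n A _ leAn]; first by rewrite cards0.
    by apply: leq_trans (leq_card_setU _ _) _; rewrite leq_add2l.
  rewrite -[X in X * _]card_ord -sum_nat_const.
  by apply: leq_sum => i _; exact: card_uncut_forest.
(* [hk] supplies the color of the default element that [rado] asks for. *)
have [x [trim_x rank_x]] := rado (@colored_rank0 V k) (@colored_rankS V k)
  (@colored_rank_submod V k) (Ordinal hk, set0) (rado_condition_hedges uncut_le).
(* The chosen element [x e] encodes both the class of [e], as its color, and the trimmed edge, as
   its second component. *)
pose F i := [set e in hedges G | (x e).1 == i].
exists F; split=> [i j neq_ij | | i].
- rewrite disjoint_subset; apply/subsetP=> e /[!inE] /andP[_ /eqP->].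
  by rewrite negb_and neq_ij orbT.
- apply/setP=> e; apply/bigcupP/idP=> [[i _ /[!inE] /andP[]] // | eG].
  by exists (x e).1; rewrite ?inE ?eG ?eqxx.
have trimF : is_trimming (F i) (snd \o x).
  move=> e /[!inE] /andP[/trim_x /[!inE] xe _].
  by apply/trimmed_edgesP; rewrite inE.
exists (snd \o x) => //; apply: independent_forest => [e /trimF | X sXF].
  by case=> h [u [v [_ _ _ neq_uv ->]]]; exists u, v.
(* All elements chosen on [X] have color [i], so the colored rank bound from [rado] is a bound on
   their graphic rank. *)
rewrite imset_comp -(@colored_rank_monochromatic _ _ _ i).
  apply: rank_x; apply: subset_trans sXF _.
  by apply/subsetP=> e /[!inE] /andP[].
by move=> y /imsetP[e /(subsetP sXF) /[!inE] /andP[_ /eqP<-] ->].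
Qed.
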